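(* Let $A$ be a sufficiently generic $d\times n$ tropical matrix with corresponding hyperplane arrangement $\mathcal{H}(A)$, and set $B=B_A\subseteq K_{d,n}$. Let $\mathcal{S}$ be the set of fine types associated to the vertices of the bounded complex $\mathcal{B}(A)$, and let $\mathbf{1}=(1,\dots,1)\in\mathbb{Z}^n$. Then the set of $B$-draconian sequences is $$\{\mathrm{RD}(T)-\mathbf{1}: T\in\mathcal{S}\}.$$
   Context: A $d\times n$ tropical matrix is a matrix $A=(a_{ik})$ with entries in $\mathbb{R}\cup\{\infty\}$ such that every column has at least one finite entry. $B_A\subseteq K_{d,n}$ is the bipartite graph on $[d]\sqcup[n]$ with an edge $(i,k)$ iff $a_{ik}$ is finite. $A$ is sufficiently generic if the regular subdivision of the root polytope $Q_{B_A}=\mathrm{conv}\{\mathbf{e}_i-\mathbf{e}_{\bar j}:(i,j)\in E(B_A)\}\subset\mathbb{R}^{d+n}$ obtained by lifting $\mathbf{e}_i-\mathbf{e}_{\bar j}$ to height $a_{ij}$ and projecting the lower faces is a triangulation. Let $\mathbb{1}\in\mathbb{R}^d$ be the all-ones vector. $\mathcal{H}(A)$ is the arrangement of max-tropical hyperplanes with apices the columns $\mathbf{a}_k$ of $A$; the $i$-th closed sector of the $k$-th one is $S_i(\mathbf{a}_k)=\{\mathbf{p}\in\mathbb{R}^d/\mathbb{R}\mathbb{1}: p_i-a_{ik}\ge p_j-a_{jk}\ \forall j\in[d]\}$ (with $p_j-\infty=-\infty$). The fine type of $\mathbf{p}$ is $T(\mathbf{p})\in\{0,1\}^{d\times n}$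 with $T(\mathbf{p})_{ik}=1$ iff $a_{ik}$ is finite and $\mathbf{p}\in S_i(\mathbf{a}_k)$. For each fine type $T$ that occurs, $C_T=\{\mathbf{q}:T(\mathbf{q})\ge T\}$ is a closed cell; these cells form the tropical complex, a polyhedral subdivision of $\mathbb{R}^d/\mathbb{R}\mathbb{1}$, and $\mathcal{B}(A)$ is its subcomplex of bounded cells. The right degree vector of a fine type $T$ is $\mathrm{RD}(T)\in\mathbb{N}^n$, $\mathrm{RD}(T)_k=\sum_iT_{ik}$. Draconian sequences (Postnikov). Let $N_j(B)\subseteq[d]$ be the neighbours of $j\in[n]$ in $B$. A sequence of nonnegative integers $(a_1,\dots,a_n)$ is $B$-draconian if $\sum_ja_j=d-1$ and for every non-empty subset $\{j_1<\dots<j_k\}\subseteq[n]$ we have $|N_{j_1}(B)\cup\dots\cup N_{j_k}(B)|\ge a_{j_1}+\dots+a_{j_k}+1$. *)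

(* Defs.v *)
From HB Require Import structures.
From mathcomp Require Import all_boot all_order all_algebra.
From mathcomp Require Import boolp classical_sets reals constructive_ereal.

Set Implicit Arguments.
Unset Strict Implicit.
Unset Printing Implicit Defensive.

Import Order.TTheory GRing.Theory Num.Theory.

Local Open Scope classical_set_scope.
Local Open Scope ring_scope.

Section Polytopes.
Variables (R : realType) (V : lmodType R).

Definition conv (S : set V) : set V :=
  [set x | exists m (v : 'I_m -> V) (w : 'I_m -> R),
     [/\ forall i, S (v i), forall i, 0 <= w i, \sum_i w i = 1
       & x = \sum_i w i *: v i]].

Definition affinely_independent m (v : 'I_m -> V) : Prop :=
  forall w : 'I_m -> R,
    \sum_i w i = 0 -> \sum_i w i *: v i = 0 -> forall i, w i = 0.

(* m = 0 is allowed: the empty set is the (-1)-dimensional simplex. *)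
Definition is_simplex (S : set V) : Prop :=
  exists m (v : 'I_m -> V), affinely_independent v /\ S = conv (range v).

End Polytopes.

Section RegularSubdivision.
Variables (R : realType) (V : lmodType R).

(* A lower face minimizes a linear functional that increases with the height
   coordinate.  R^o is R as a module over itself, so that V * R^o is a module. *)
Definition lower_face (P F : set (V * R^o)%type) : Prop :=
  exists phi : {scalar (V * R^o)%type},
    0 < phi (0, 1) /\ F = [set x | P x /\ forall y, P y -> phi x <= phi y].

Definition regular_subdivision (L : set (V * R^o)%type) : set (set V) :=
  [set fst @` F | F in lower_face (conv L)].

End RegularSubdivision.

Section Tropical.
Variables (R : realType) (d n : nat).
Implicit Types (A : 'M[\bar R]_(d, n)) (p q : 'rV[R]_d) (T : 'M[bool]_(d, n)).

(* \bar R also contains -oo, which is not a tropical number. *)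
Definition tropical_matrix A : Prop :=
  (forall i k, A i k != -oo%E) /\ (forall k, exists i, A i k \is a fin_num).

Definition support_graph A : {set 'I_d * 'I_n} :=
  [set e : 'I_d * 'I_n | A e.1 e.2 \is a fin_num].

(* e_i - e_{\bar j} in R^{d+n} *)
Definition root_vec (i : 'I_d) (j : 'I_n) : 'rV[R]_(d + n) :=
  row_mx (delta_mx 0 i) (- delta_mx 0 j).

Definition lifted_roots A : set ('rV[R]_(d + n) * R^o)%type :=
  [set x | exists i j, (i, j) \in support_graph A /\
                       x = (root_vec i j, fine (A i j) : R^o)].

(* The underlying set of regular_subdivision (lifted_roots A) is the root
   polytope of support_graph A. *)
Definition sufficiently_generic A : Prop :=
  forall C, regular_subdivision (lifted_roots A) C -> is_simplex C.

(* Points of R^d/R1 are given by representatives in R^d, and subsets of R^d/R1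
   by their preimages in R^d.  The subtraction of +oo below yields -oo. *)
Definition sector A (k : 'I_n) (i : 'I_d) : set 'rV[R]_d :=
  [set p | forall j, ((p 0 j)%:E - A j k <= (p 0 i)%:E - A i k)%E].

Definition fine_type A p : 'M[bool]_(d, n) :=
  \matrix_(i, k) ((A i k \is a fin_num) && (p \in sector A k i)).

Definition fine_types A : set 'M[bool]_(d, n) := range (fine_type A).

Definition cell A T : set 'rV[R]_d :=
  [set q | forall i k, T i k -> fine_type A q i k].

Definition tropical_complex A : set (set 'rV[R]_d) :=
  [set cell A T | T in fine_types A].

Definition torus_point p : set 'rV[R]_d :=
  [set q | exists c : R, q = p + const_mx c].

(* boundedness of the image in R^d/R1 *)
Definition torus_bounded (C : set 'rV[R]_d) : Prop :=
  exists M : R, forall q, C q -> exists c : R, forall i, `|q 0 i + c| <= M.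

Definition bounded_complex A : set (set 'rV[R]_d) :=
  [set C | tropical_complex A C /\ torus_bounded C].

Definition bounded_complex_vertices A : set (set 'rV[R]_d) :=
  [set C | bounded_complex A C /\ exists p, C = torus_point p].

Definition vertex_fine_types A : set 'M[bool]_(d, n) :=
  [set T | fine_types A T /\ bounded_complex_vertices A (cell A T)].

Definition right_degree T : 'rV[nat]_n := \row_k (\sum_i T i k)%N.

End Tropical.

Section Draconian.
Variables d n : nat.

Definition neighbours (B : {set 'I_d * 'I_n}) (j : 'I_n) : {set 'I_d} :=
  [set i | (i, j) \in B].

(* Nonnegative integer sequences are taken in Z^n, so that d - 1 and the
   subtraction of the all-ones vector are not truncated. *)
Definition draconian (B : {set 'I_d * 'I_n}) (a : 'rV[int]_n) : Prop :=
  [/\ forall j, 0 <= a 0 j,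
      \sum_j a 0 j = d%:Z - 1
    & forall J : {set 'I_n}, J != finset.set0 ->
        \sum_(j in J) a 0 j + 1
          <= #|(\bigcup_(j in J) neighbours B j)%SET|%:Z].

End Draconian.

(* Main.v *)
Require Import Defs.
From HB Require Import structures.
From mathcomp Require Import all_boot all_order all_algebra.
From mathcomp Require Import boolp classical_sets reals constructive_ereal.
From mathcomp Require Import finset zify ring lra.

(** A point [p] together with the heights [y k = max_i (p i - a i k)] of its
    columns has a tight graph: the edges [(i, k)] that attain the maximum.  This
    graph is the fine type of [p].  The theorem compares spanning trees that
    occur as tight graphs with draconian sequences, and three facts carry it.

    - The vertices of the bounded complex are the points whose tight graph is
      connected: along a splitting of the rows compatible with the graph one can
      move the point without losing an edge, and if there is no such proper
      splitting then the edges determine the point up to translation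
      ([vertex_fine_typeP]).
    - Genericity bounds the number of tight edges by [d + n - 1].  The functional
      [x |-> height - <p, y; x>] is nonnegative on the lifted roots and vanishes
      exactly on the tight ones, so the tight roots span a cell of the regular
      subdivision; they are among the vertices of a simplex in an affine space of
      dimension [d + n - 2] ([generic_tight_bound]).
    - Every draconian sequence of the support graph is a draconian sequence of
      some connected tight graph ([draconian_attained]).  This is linear
      programming duality for the transportation problem with supply 1 at every
      row and demand [a k + 1/n] at column [k]: at a minimum of the dual objective
      [sum_k (n a k + 1) y k - n sum_i p i], lowering the rows [N(J)] adjacent to
      a set [J] of columns cannot decrease the objective, and by integrality this
      gives the draconian inequality for [J] in the tight graph.  The minimum exists
      because every point can be moved to a connected one without increasing the
      objective ([connected_improve]), and up to translation there are only
      finitely many connected points.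

    A connected tight graph with at most [d + n - 1] edges is a spanning tree, and
    growing a set of rows through its columns shows that its right degrees minus
    one are draconian ([draconian_of_tree]).  Conversely, if [a] is draconian for
    the tight graph, singletons [J] give [a k + 1 <= deg k]; summing over [k] and
    comparing with the bound on the number of edges forces equality. *)

Set Implicit Arguments.
Unset Strict Implicit.
Unset Printing Implicit Defensive.

Import Order.TTheory GRing.Theory Num.Theory.

Local Open Scope ring_scope.

(** * Connected and draconian families of sets *)

Section SetFamilies.
Variables (I K : finType).
Implicit Types (N : K -> {set I}) (U : {set I}) (J : {set K}) (a : K -> nat).

(** A bipartite graph between rows [I] and columns [K] is given by the sets [N k] of
    rows adjacent to the columns.  When no [N k] is empty, a union of connected
    components is determined by its rows, so connectedness can be tested on sets
    of rows alone. *)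
Definition splits N U := [forall k, (N k \subset U) || [disjoint N k & U]].

Definition connected_family N :=
  forall U, U != set0 -> splits N U -> U = setT.

(** Draconian sequences with values in [nat]; the strict inequality absorbs the [+ 1]. *)
Definition draconian_seq N a :=
  (\sum_k a k + 1 = #|I|)%N /\
  forall J, J != set0 -> (\sum_(k in J) a k < #|\bigcup_(k in J) N k|)%N.

Lemma sub_leq_sum (P Q : pred K) (a : K -> nat) : (forall k, P k -> Q k) ->
  (\sum_(k | P k) a k <= \sum_(k | Q k) a k)%N.
Proof.
move=> PQ; rewrite [leqRHS](bigID P) /=.
suff -> : (\sum_(k | P k) a k = \sum_(k | Q k && P k) a k)%N by apply: leq_addr.
by apply: eq_bigl => k; case: (boolP (P k)) => [/PQ->|]; rewrite ?andbF.
Qed.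

(** Start from the rows [U]; as long as some row is missing, connectedness gives
    a column that meets both the current set and its complement, and absorbing
    it adds at most [#|N k| - 1] rows.  Only columns not contained in [U] are
    ever absorbed. *)
Lemma connected_growth N U : connected_family N -> U != set0 ->
  (#|I| <= #|U| + \sum_(k | ~~ (N k \subset U)) #|N k|.-1)%N.
Proof.
move=> conN; have [m] := ubnP #|~: U|; elim: m U => // m IHm U ltUm U0.
have [/(conN U U0)->|] := boolP (splits N U); first by rewrite cardsT leq_addr.
case/forallPn=> k; rewrite negb_or => /andP[NkU meetU].
have ltU : (#|U| < #|U :|: N k|)%N.
  apply: proper_card; rewrite properE subsetUl /=.
  by apply: contra NkU; rewrite subUset => /andP[].
have cardU : (#|U :|: N k| <= #|U| + #|N k|.-1)%N.
  have : (0 < #|U :&: N k|)%N.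
    by rewrite card_gt0 setI_eq0 disjoint_sym.
  have := cardsUI U (N k); lia.
have ltUNm : (#|~: (U :|: N k)| < m)%N.
  by have := cardsC U; have := cardsC (U :|: N k); lia.
have UN0 : U :|: N k != set0.
  by apply: contraNneq U0 => UN; rewrite -subset0 -UN subsetUl.
have := IHm _ ltUNm UN0; rewrite (bigD1 (P := fun j => ~~ (N j \subset U)) k) //=.
suff: (\sum_(j | ~~ (N j \subset U :|: N k)) #|N j|.-1 <=
   \sum_(j | ~~ (N j \subset U) && (j != k)) #|N j|.-1)%N by lia.
apply: sub_leq_sum => j nj; apply/andP; split.
  by apply: contra nj => NjU; apply: fintype.subset_trans NjU (subsetUl _ _).
by apply: contraNneq nj => ->; rewrite subsetUr.
Qed.

Lemma draconian_lt_card N a k : draconian_seq N a -> (a k < #|N k|)%N.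
Proof.
case=> _ /(_ [set k]%SET); rewrite !big_set1 -card_gt0 cards1; exact.
Qed.

(** The bound on the edges says that the connected family is a tree.  Growth from a
    single row gives the total, and growth from the rows of [J] leaves at
    most the columns outside [J] to absorb, which bounds the degrees inside [J]
    by complementation. *)
Lemma draconian_of_tree N : (0 < #|I|)%N -> connected_family N ->
  (forall k, 0 < #|N k|)%N -> (\sum_k #|N k| < #|I| + #|K|)%N ->
  draconian_seq N (fun k => #|N k|.-1).
Proof.
move=> /card_gt0P[i0 _] conN Ngt0 edges.
have sumN : (\sum_k #|N k| = \sum_k #|N k|.-1 + #|K|)%N.
  rewrite -sum1_card -big_split /=; apply: eq_bigr => k _.
  by have := Ngt0 k; lia.
have total : (\sum_k #|N k|.-1 + 1 = #|I|)%N.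
  have i00 : [set i0]%SET != set0 by apply/set0Pn; exists i0; rewrite inE.
  have := connected_growth conN i00; rewrite cards1.
  have : (\sum_(k | ~~ (N k \subset [set i0]%SET)) #|N k|.-1 <= \sum_k #|N k|.-1)%N.
    exact: sub_leq_sum.
  by lia.
split=> // J /set0Pn[k0 Jk0].
set U := (\bigcup_(k in J) N k)%SET.
have U0 : U != set0.
  have /card_gt0P[i Ni] := Ngt0 k0.
  by apply/set0Pn; exists i; apply/bigcupP; exists k0.
have grow := connected_growth conN U0.
have outJ : (\sum_(k | ~~ (N k \subset U)) #|N k|.-1 <= \sum_(k | k \notin J) #|N k|.-1)%N.
  by apply: sub_leq_sum => k; apply: contra => Jk; apply: bigcup_sup.
by move: total grow; rewrite (bigID (fun k => k \in J)) /=; lia.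
Qed.

End SetFamilies.

Lemma draconian_seq_mono (I K : finType) (N N' : K -> {set I}) al :
  (forall k, N k \subset N' k) -> draconian_seq N al -> draconian_seq N' al.
Proof.
move=> NN' [total drag]; split=> // J /drag ltJ; apply: leq_trans ltJ _.
apply/subset_leq_card/bigcupsP => k kJ.
exact: fintype.subset_trans (NN' k) (bigcup_sup _ kJ).
Qed.

Lemma draconianP d n (B : {set 'I_d * 'I_n}) (a : 'rV[int]_n) (al : 'I_n -> nat) :
  (forall k, a 0 k = (al k)%:Z) -> draconian B a <-> draconian_seq (neighbours B) al.
Proof.
move=> aE.
have sumE (P : pred 'I_n) : \sum_(k | P k) a 0 k = (\sum_(k | P k) al k)%N%:Z.
  by rewrite (big_morph Posz PoszD (erefl 0)); apply: eq_bigr.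
split=> [[_ total drag]|[total drag]].
  split; first by move: total; rewrite sumE card_ord; lia.
  by move=> J /drag; rewrite sumE -PoszD lez_nat addn1.
split=> [k||J /drag].
- by rewrite aE.
- by move: total; rewrite sumE card_ord; lia.
- by rewrite sumE -PoszD lez_nat addn1.
Qed.

Lemma leq_sum_eq (K : finType) (f g : K -> nat) :
  (forall k, f k <= g k)%N -> (\sum_k g k <= \sum_k f k)%N -> f =1 g.
Proof.
move=> fg gf k; apply/eqP; rewrite eqn_leq fg /= leqNgt; apply/negP => ltk.
move: gf; rewrite (bigD1 k) //= [leqRHS](bigD1 k) //= leqNgt => /negP; apply.
by rewrite -addSn leq_add // leq_sum.
Qed.

(** * Points, column heights and tight edges *)

(** A tropical matrix is given by the sets [B k] of rows where column [k] is finite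
    and by the entries [a] there. *)
Section Heights.
Variables (R : realFieldType) (I K : finType) (B : K -> {set I}) (a : I -> K -> R).
Implicit Types (p q : I -> R) (y z : K -> R) (U : {set I}) (t : R).

Definition tight p y k : {set I} := [set i in B k | p i - a i k == y k]%SET.

Definition heights p y := forall k,
  (forall i, i \in B k -> p i - a i k <= y k) /\ tight p y k != set0.

Lemma heights_exist p : (forall k, B k != set0) -> exists y, heights p y.
Proof.
move=> B0; suff: forall k, exists h, (forall i, i \in B k -> p i - a i k <= h) /\
    [set i in B k | p i - a i k == h]%SET != set0.
  by move/choice => [y yP]; exists y.
move=> k; have /set0Pn[i0 Bi0] := B0 k.
case: (arg_maxP (fun i => p i - a i k) Bi0) => i Bi maxi.
exists (p i - a i k); split; first by move=> j Bj; apply: maxi.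
by apply/set0Pn; exists i; rewrite inE [_ \in _]Bi eqxx.
Qed.

(** Lowering the rows of [U] by a small [t] lowers exactly the heights of the columns
    whose tight rows all lie in [U]; the formula for the heights stays correct
    until a row outside [U] becomes tight in one of these columns.  The rows that
    can do so are the blocking ones. *)
Definition lower_point p U t i := p i - t *+ (i \in U).

Definition lower_heights p y U t k := y k - t *+ (tight p y k \subset U).

Definition blocking p y U k := if tight p y k \subset U then B k :\: U else set0.

Lemma lower_heightsP p y U t : heights p y -> 0 <= t ->
  (forall k i, i \in blocking p y U k -> p i - a i k <= y k - t) ->
  heights (lower_point p U t) (lower_heights p y U t).
Proof.
move=> hpy t0 ht k; rewrite /lower_point /lower_heights.
have [le_y /set0Pn[j jk]] := hpy k; split.
  move=> i Bi; have := le_y i Bi; have := ht k i; rewrite /blocking.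
  case: (boolP (tight p y k \subset U)) => // kU; case: (boolP (i \in U)) => // iU.
  - by move=> _; rewrite mulr1n; lra.
  - by rewrite inE iU Bi => /(_ isT); rewrite mulr0n mulr1n; lra.
  - by move=> _; rewrite mulr0n mulr1n; lra.
  - by move=> _; rewrite mulr0n; lra.
apply/set0Pn; rewrite /tight; case: (boolP (_ \subset U)) => kU.
  exists j; have jU := fintype.subsetP kU _ jk; move: jk; rewrite !inE jU.
  by case/andP=> -> /eqP <- /=; apply/eqP; ring.
have /fintype.subsetPn[i ik iU] := kU; exists i; move: ik; rewrite !inE (negbTE iU).
by case/andP=> -> /eqP <- /=; apply/eqP; ring.
Qed.

(** A blocking row is not tight, so a positive step is always possible; if there are
    blocking rows, the largest step makes one of them tight. *)
Lemma lower_step p y U : heights p y -> exists2 t, 0 < t &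
  (forall k i, i \in blocking p y U k -> p i - a i k <= y k - t) /\
  ((exists k, blocking p y U k != set0) ->
    exists k i, i \in blocking p y U k /\ p i - a i k = y k - t).
Proof.
move=> hpy.
have [[e0 he0]|no_block] := pselect (exists e : K * I, e.2 \in blocking p y U e.1); last first.
  exists 1 => //; split; first by move=> k i ki; case: no_block; exists (k, i).
  by case=> k /set0Pn[i ki]; case: no_block; exists (k, i).
case: (@arg_minP _ _ _ e0 (fun e : K * I => e.2 \in blocking p y U e.1)
   (fun e => y e.1 - (p e.2 - a e.2 e.1)) he0) => -[k i] /= ki mini.
exists (y k - (p i - a i k)).
  have [le_y _] := hpy k; move: ki; rewrite /blocking.
  case: ifP => [kU|]; last by rewrite inE.
  rewrite inE => /andP[iU Bi].
  rewrite subr_gt0 lt_neqAle le_y // andbT.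
  apply: contraNneq iU => eqy; apply: (fintype.subsetP kU).
  by rewrite inE Bi eqy eqxx.
split; first by move=> k' i' ki'; have := mini (k', i') ki' => /=; lra.
by move=> _; exists k, i; split=> //; ring.
Qed.

(** Along a splitting the rows of a column move together with its height. *)
Lemma tight_lower_splits p y U t k : splits (tight p y) U ->
  tight p y k \subset tight (lower_point p U t) (lower_heights p y U t) k.
Proof.
move=> /forallP/(_ k) spl; apply/fintype.subsetP => i ik.
rewrite inE /lower_point /lower_heights.
have -> : (tight p y k \subset U) = (i \in U); last first.
  by move: ik; rewrite inE => /andP[-> /eqP <-] /=; apply/eqP; ring.
apply/idP/idP => [kU|iU]; first exact: (fintype.subsetP kU).
by case/orP: spl => // /pred0P/(_ i) /=; rewrite iU ik.
Qed.

(** The dual objective of the transportation problem with demands [w k] and supply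
    [m] at every row. *)
Definition cost (w : K -> nat) (m : nat) p y : R :=
  \sum_k (w k)%:R * y k - m%:R * \sum_i p i.

Lemma cost_lower w m p y U t :
  cost w m (lower_point p U t) (lower_heights p y U t) =
  cost w m p y - t * ((\sum_(k | tight p y k \subset U) w k)%:R - (m * #|U|)%:R).
Proof.
rewrite /cost /lower_point /lower_heights.
have -> : \sum_i (p i - t *+ (i \in U)) = \sum_i p i - t * #|U|%:R.
  rewrite sumrB -sum1_card natr_sum mulr_sumr; congr (_ - _).
  rewrite [RHS]big_mkcond /=; apply: eq_bigr => i _.
  by case: (i \in U); rewrite ?mulr1.
have -> : \sum_k (w k)%:R * (y k - t *+ (tight p y k \subset U)) =
    \sum_k (w k)%:R * y k - t * (\sum_(k | tight p y k \subset U) w k)%:R.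
  rewrite natr_sum mulr_sumr [X in _ - X]big_mkcond -sumrB /=.
  by apply: eq_bigr => k _; case: (_ \subset U) => /=; rewrite ?mulr0n; ring.
by rewrite natrM; ring.
Qed.

Lemma cost_translate w m p y c : (\sum_k w k = m * #|I|)%N ->
  cost w m (fun i => p i + c) (fun k => y k + c) = cost w m p y.
Proof.
move=> sw; rewrite /cost big_split /= sumr_const.
under eq_bigr do rewrite mulrDr.
by rewrite big_split /= -mulr_suml -natr_sum sw natrM -mulr_natl; ring.
Qed.

(** On the tight rows of a column, [q - p] equals the difference of the heights, so
    its level sets split the tight graph of [p]. *)
Lemma connected_translate p y q z : (0 < #|I|)%N -> heights p y ->
    connected_family (tight p y) ->
    (forall k, tight p y k \subset tight q z k) ->
  exists c, q =1 (fun i => p i + c) /\ z =1 (fun k => y k + c).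
Proof.
move=> /card_gt0P[i0 _] hpy conp sub.
have shift k i : i \in tight p y k -> q i - p i = z k - y k.
  move=> ik; have := fintype.subsetP (sub k) _ ik; move: ik; rewrite !inE.
  by move=> /andP[_ /eqP <-] /andP[_ /eqP <-]; ring.
pose U := [set i | q i - p i == q i0 - p i0]%SET.
have UT : U = setT.
  apply: conp; first by apply/set0Pn; exists i0; rewrite inE.
  apply/forallP => k; case: (boolP [disjoint _ & _]); rewrite ?orbT //.
  case/pred0Pn=> i /= /andP[ik]; rewrite inE orbF => /eqP iU.
  apply/fintype.subsetP => j jk; rewrite inE -iU.
  by rewrite (shift _ _ jk) (shift _ _ ik).
have qp i : q i - p i = q i0 - p i0.
  by have : i \in U; [rewrite UT inE | rewrite inE => /eqP].
exists (q i0 - p i0); split=> [i|k]; first by rewrite -(qp i); ring.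
have [_ /set0Pn[i ik]] := hpy k.
by rewrite -(qp i) (shift _ _ ik); ring.
Qed.

(** The demands [al k + 1 / #|K|], scaled by [#|K|] to be integral.  The fractional
    part makes the total demand match the total supply, and it is small enough
    for [al] to be draconian as soon as every set of demands fits into its
    neighbourhood. *)
Definition draconian_weight (al : K -> nat) k := (#|K| * al k + 1)%N.

Lemma sum_draconian_weight al (J : {pred K}) :
  (\sum_(k in J) draconian_weight al k = #|K| * (\sum_(k in J) al k) + #|J|)%N.
Proof. by rewrite big_split /= -big_distrr /= sum1_card. Qed.

(** The cost is linear along a splitting, so lowering one of its two sides does not
    increase it.  The draconian condition provides a blocking row, and the largest
    step gains a tight edge without losing one; this can happen only finitely
    often. *)
Lemma connected_improve al p y : draconian_seq B al -> heights p y ->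
  exists p' y', [/\ heights p' y', connected_family (tight p' y') &
    cost (draconian_weight al) #|K| p' y' <= cost (draconian_weight al) #|K| p y].
Proof.
move=> [total drag]; set w := draconian_weight al.
have sumw : (\sum_k w k = #|K| * #|I|)%N.
  by rewrite sum_draconian_weight -total mulnDr muln1 cardE -cardT.
have [m] := ubnP (#|K| * #|I| - \sum_k #|tight p y k|)%N.
elim: m p y => // m IHm p y ltm hpy.
have [con|] := pselect (connected_family (tight p y)); first by exists p, y.
move=> disc; have [U [U0 UT spl wU]] : exists U : {set I},
    [/\ U != set0, U != setT, splits (tight p y) U &
      (#|K| * #|U| <= \sum_(k | tight p y k \subset U) w k)%N].
  have [U] : exists U : {set I}, ~ (U != set0 -> splits (tight p y) U -> U = setT).
    by apply: contrapT => noU; apply: disc => U U0 spl; apply: contrapT => UT;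
       apply: noU; exists U => /(_ U0 spl).
  move=> /not_implyP[U0 /not_implyP[spl /eqP UT]].
  (* The slopes of the cost along a set and along its complement are opposite. *)
  have [|ltU] := leqP (#|K| * #|U|) (\sum_(k | tight p y k \subset U) w k).
    by exists U.
  exists (~: U).
  have tightC k : (tight p y k \subset ~: U) = ~~ (tight p y k \subset U).
    rewrite -disjoints_subset; have [_ /set0Pn[i ik]] := hpy k.
    case/orP: (forallP spl k) => [kU|dis].
      rewrite kU; apply/negbTE/pred0Pn; exists i => /=.
      by rewrite ik (fintype.subsetP kU).
    rewrite dis; symmetry; apply/fintype.subsetPn; exists i => //.
    by move/pred0P: dis => /(_ i) /=; rewrite ik /= => ->.
  split.
  - by apply: contraNneq UT => UC; rewrite -(setCK U) UC setC0.
  - by apply: contraNneq U0 => UC; rewrite -(setCK U) UC setCT.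
  - apply/forallP => k; rewrite tightC.
    by case: (boolP (_ \subset U)) => //= kU; rewrite disjoints_subset setCK.
  have := sumw; rewrite (bigID (fun k => tight p y k \subset U)) /=.
  under [leqRHS]eq_bigl do rewrite tightC.
  by move: ltU (cardsC U) => /=; nia.
have [t t0 [t_le t_eq]] := lower_step U hpy.
have hpy' := lower_heightsP hpy (ltW t0) t_le.
pose J := [set k | tight p y k \subset U]%SET.
have wJ : (\sum_(k | tight p y k \subset U) w k = #|K| * (\sum_(k in J) al k) + #|J|)%N.
  by rewrite -sum_draconian_weight; apply: eq_bigl => k; rewrite inE.
have ltUI : (#|U| < #|I|)%N.
  by rewrite -cardsT; apply: proper_card; rewrite properT.
(* Without blocking rows the columns inside [U] have all their finite rows in [U]; then
   the draconian inequality contradicts the slope of the cost unless these are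
   all the columns, and in that case it contradicts that [U] is proper. *)
have block : exists k, blocking p y U k != set0.
  apply: contrapT => no_block.
  have BJ k : k \in J -> B k \subset U.
    rewrite inE => kU; apply: contrapT => /negP /fintype.subsetPn[i Bi iU].
    apply: no_block; exists k; apply/set0Pn; exists i.
    by rewrite /blocking kU inE iU.
  have alJ : (\sum_(k in J) al k < #|U|)%N.
    have [->|J0] := eqVneq J set0.
      by rewrite big_set0 card_gt0.
    apply: leq_trans (drag J J0) _; apply: subset_leq_card.
    by apply/bigcupsP => k; apply: BJ.
  have JT : J = setT.
    apply/eqP; rewrite -subTset -setCS setCT subset0 -cards_eq0.
    have := cardsC J; move: wU; rewrite wJ; nia.
  move: alJ ltUI total; rewrite JT (eq_bigl predT) => [/= | k]; first by lia.
  by rewrite inE.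
have [k [i [ki eqy]]] := t_eq block.
have tight_sub := tight_lower_splits t _ spl.
have tight_lt : (\sum_k #|tight p y k| <
    \sum_k #|tight (lower_point p U t) (lower_heights p y U t) k|)%N.
  rewrite [ltnLHS](bigD1 k) // [ltnRHS](bigD1 k) //= -addSn leq_add //; last first.
    by apply: leq_sum => j _; apply: subset_leq_card.
  apply: proper_card; apply/properP; split=> //.
  move: ki; rewrite /blocking; case: ifP => [kU|]; last by rewrite inE.
  rewrite inE => /andP[iU Bi]; exists i.
    rewrite inE Bi /lower_point /lower_heights (negbTE iU) kU mulr0n subr0 eqy.
    by rewrite mulr1n eqxx.
  by apply: contra iU; apply: fintype.subsetP.
have tight_le : (\sum_k #|tight (lower_point p U t) (lower_heights p y U t) k| <=
    #|K| * #|I|)%N.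
  by rewrite -sum_nat_const; apply: leq_sum => j _; apply: max_card.
have {IHm}[|p'' [y'' [hpy'' con'' cost'']]] := IHm _ _ _ hpy'; first lia.
exists p'', y''; split=> //; apply: le_trans cost'' _.
rewrite cost_lower gerBl; apply: mulr_ge0 (ltW t0) _.
by rewrite subr_ge0 ler_nat.
Qed.

(** Connected points with the same tight family are translates of each other and have
    the same cost, so it suffices to compare one representative for each of the
    finitely many families. *)
Lemma cost_minimum (w : K -> nat) m p0 y0 : (0 < #|I|)%N ->
    (\sum_k w k = m * #|I|)%N ->
    heights p0 y0 -> connected_family (tight p0 y0) ->
  exists p y, [/\ heights p y, connected_family (tight p y) &
    forall q z, heights q z -> connected_family (tight q z) ->
      cost w m p y <= cost w m q z].
Proof.
move=> I0 sw h0 c0.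
pose attained (T : {ffun K -> {set I}}) (e : (I -> R) * (K -> R)) :=
  [/\ heights e.1 e.2, connected_family (tight e.1 e.2) & tight e.1 e.2 =1 T].
have [rep repP] : exists rep, forall T, (exists e, attained T e) -> attained T (rep T).
  suff: forall T, exists r, (exists e, attained T e) -> attained T r.
    by case/choice => rep repP; exists rep.
  move=> T; have [[e eT]|no] := pselect (exists e, attained T e); first by exists e.
  by exists (p0, y0).
have tightT q z : heights q z -> connected_family (tight q z) ->
    attained [ffun k => tight q z k] (q, z).
  by move=> hq cq; split=> // k; rewrite ffunE.
pose T0 := [ffun k => tight p0 y0 k].
have PT0 : `[< exists e, attained T0 e >] by apply/asboolP; exists (p0, y0); apply: tightT.
case: (@arg_minP _ _ _ T0 (fun T => `[< exists e, attained T e >])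
  (fun T => cost w m (rep T).1 (rep T).2) PT0) => T /asboolP/repP[hT cT _] minT.
exists (rep T).1, (rep T).2; split=> // q z hq cq.
pose S := [ffun k => tight q z k].
have PS : exists e, attained S e by exists (q, z); apply: tightT.
apply: le_trans (minT S _) _; first exact/asboolP.
have [hS cS eS] := repP _ PS.
have [k|c [qE zE]] := connected_translate I0 hS cS (q := q) (z := z).
  by rewrite eS ffunE.
rewrite -(cost_translate (rep S).1 (rep S).2 c sw) /cost.
by under eq_bigr do rewrite -zE; under [X in _ * X]eq_bigr do rewrite -qE.
Qed.

(** Take a connected point of minimal cost.  If the draconian inequality of its tight
    family failed for [J], then lowering the rows adjacent to [J] would lower
    all columns of [J], whose weight exceeds that of the rows, and the cost would
    decrease below the minimum. *)
Lemma draconian_attained al : (0 < #|I|)%N -> draconian_seq B al ->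
  exists p y, [/\ heights p y, connected_family (tight p y) & draconian_seq (tight p y) al].
Proof.
move=> I0 drag; have [total _] := drag.
have B0 k : B k != set0.
  by rewrite -card_gt0; apply: leq_ltn_trans (draconian_lt_card k drag).
have sw : (\sum_k draconian_weight al k = #|K| * #|I|)%N.
  by rewrite sum_draconian_weight -total mulnDr muln1 cardE -cardT.
have [y1 h1] := heights_exist (fun=> 0) B0.
have [p2 [y2 [h2 c2 _]]] := connected_improve drag h1.
have [p [y [h c minpy]]] := cost_minimum I0 sw h2 c2.
exists p, y; split=> //; split=> // J J0.
set U := (\bigcup_(k in J) _)%SET; rewrite ltnNge; apply/negP => leU.
have [t t0 [t_le _]] := lower_step U h.
have [p' [y' [h' c' cost']]] := connected_improve drag (lower_heightsP h (ltW t0) t_le).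
have := le_trans (minpy _ _ h' c') cost'; rewrite cost_lower leNgt => /negP; apply.
rewrite ltrBlDr ltrDl; apply: mulr_gt0 t0 _; rewrite subr_gt0 ltr_nat.
have : (\sum_(k in J) draconian_weight al k <=
    \sum_(k | tight p y k \subset U) draconian_weight al k)%N.
  by apply: sub_leq_sum => k; apply: bigcup_sup.
rewrite sum_draconian_weight; move: J0; rewrite -card_gt0 => /=; nia.
Qed.

End Heights.

(** * Simplices spanned by roots *)

Section Convexity.
Variables (R : realType) (V : lmodType R).

Lemma conv_sub (S : set V) x : S x -> conv S x.
Proof.
move=> Sx; exists 1%N, (fun=> x), (fun=> 1); split=> //.
  by rewrite big_ord_recl big_ord0 addr0.
by rewrite big_ord_recl big_ord0 addr0 scale1r.
Qed.

Lemma conv_ge0 (f : {scalar V}) (S : set V) x :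
  (forall s, S s -> 0 <= f s) -> conv S x -> 0 <= f x.
Proof.
move=> f0 [m [v [w [Sv w0 _ ->]]]]; rewrite linear_sum; apply: sumr_ge0 => i _.
by rewrite linearZ; apply: mulr_ge0 => //; apply: f0.
Qed.

Lemma mean_attains_max m (w f : 'I_m -> R) c : (forall j, 0 <= w j) ->
  \sum_j w j = 1 -> (forall j, f j <= c) -> \sum_j w j * f j = c ->
  exists j, f j = c.
Proof.
move=> w0 w1 fc fE; apply: contrapT => no.
have z : \sum_j w j * (c - f j) = 0.
  by under eq_bigr do rewrite mulrBr; rewrite sumrB fE -mulr_suml w1; ring.
have nn j : true -> 0 <= w j * (c - f j).
  by move=> _; apply: mulr_ge0 => //; rewrite subr_ge0.
move: w1; rewrite big1 => [/eqP|j _]; first by rewrite eq_sym oner_eq0.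
have := psumr_eq0P nn z (i := j) isT; move/eqP; rewrite mulf_eq0 subr_eq0 => /orP[/eqP//|/eqP cf].
by case: no; exists j.
Qed.

End Convexity.

Section RootPolytope.
Variables (R : realType) (d n : nat).
Implicit Types (x : 'rV[R]_(d + n)) (e : 'I_d * 'I_n).

(** The root polytope of the complete bipartite graph, a simplex times the negative of
    a simplex. *)
Definition simplex_product x : Prop :=
  [/\ forall i, 0 <= x 0 (lshift n i), forall k, x 0 (rshift d k) <= 0,
      \sum_i x 0 (lshift n i) = 1 & \sum_k x 0 (rshift d k) = -1].

Lemma root_vec_lshift (i : 'I_d) (k : 'I_n) i' : root_vec R i k 0 (lshift n i') = (i' == i)%:R.
Proof. by rewrite /root_vec row_mxEl mxE. Qed.

Lemma root_vec_rshift (i : 'I_d) (k : 'I_n) k' : root_vec R i k 0 (rshift d k') = - (k' == k)%:R.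
Proof. by rewrite /root_vec row_mxEr !mxE. Qed.

Lemma simplex_product_root (i : 'I_d) (k : 'I_n) : simplex_product (root_vec R i k).
Proof.
split=> [i'|k'||].
- by rewrite root_vec_lshift.
- by rewrite root_vec_rshift oppr_le0.
- rewrite (bigD1 i) //= root_vec_lshift eqxx big1 ?addr0 // => j ji.
  by rewrite root_vec_lshift (negbTE ji).
- rewrite (bigD1 k) //= root_vec_rshift eqxx big1 ?addr0 // => j jk.
  by rewrite root_vec_rshift (negbTE jk) oppr0.
Qed.

Lemma simplex_product_inj x e f : simplex_product x ->
  x 0 (lshift n e.1) = 1 -> x 0 (rshift d e.2) = -1 ->
  x 0 (lshift n f.1) = 1 -> x 0 (rshift d f.2) = -1 -> e = f.
Proof.
case: e f => [i k] [i' k'] [xl xr suml sumr] /= xi xk xi' xk'.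
congr (_, _); apply: contrapT => /eqP neq.
  have : 1 + 1 <= \sum_i x 0 (lshift n i).
    rewrite (bigD1 i) //= xi lerD2l (bigD1 i') 1?eq_sym //= xi' lerDl.
    by apply: sumr_ge0 => j _; apply: xl.
  by rewrite suml; lra.
have : \sum_k x 0 (rshift d k) <= -1 - 1.
  rewrite (bigD1 k) //= xk lerD2l (bigD1 k') 1?eq_sym //= xk' gerDl.
  by apply: sumr_le0 => j _; apply: xr.
by rewrite sumr; lra.
Qed.

Lemma simplex_product_le1 x i : simplex_product x -> x 0 (lshift n i) <= 1.
Proof.
case=> xl _ <- _; rewrite (bigD1 i) //= lerDl.
by apply: sumr_ge0 => j _; apply: xl.
Qed.

Lemma simplex_product_geN1 x k : simplex_product x -> -1 <= x 0 (rshift d k).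
Proof.
case=> _ xr _ <-; rewrite (bigD1 k) //= gerDl.
by apply: sumr_le0 => j _; apply: xr.
Qed.

(** The points satisfy the linear equation that all coordinates sum to zero, so if there
    were [d + n] of them they would be linearly dependent; and a linear dependency is
    an affine one, because the first [d] coordinates of each point sum to one. *)
Lemma affinely_independent_bound m (v : 'I_m -> 'rV[R]_(d + n)) : (0 < d)%N ->
  (forall j, simplex_product (v j)) -> affinely_independent v -> (m < d + n)%N.
Proof.
move=> d0 vP indep; rewrite ltnNge; apply/negP => le_m.
pose M := \matrix_j v j.
have M1 : M *m (const_mx 1 : 'cV_(d + n)) = 0.
  apply/colP => j; rewrite !mxE; under eq_bigr do rewrite !mxE mulr1.
  by rewrite big_split_ord /=; case: (vP j) => _ _ -> ->; rewrite subrr.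
have rkM : (\rank M < d + n)%N.
  rewrite ltn_neqAle rank_leq_col andbT; apply/negP => full.
  have := row_full_inj full (x1 := const_mx 1 : 'cV_(d + n)) (x2 := 0).
  rewrite M1 mulmx0 => /(_ erefl)/colP/(_ (lshift n (Ordinal d0)))/eqP.
  by rewrite !mxE oner_eq0.
have : kermx M != 0.
  by rewrite kermx_eq0 /row_free neq_ltn (leq_trans rkM le_m).
case/rowV0Pn=> w /sub_kermxP wM /eqP; case; apply/rowP => j; rewrite mxE.
have sumwv : \sum_j w 0 j *: v j = 0.
  by rewrite -[RHS]wM mulmx_sum_row; apply: eq_bigr => l _; rewrite rowK.
apply: (indep (fun j => w 0 j)) => //.
transitivity (\sum_i (\sum_j w 0 j *: v j) 0 (lshift n i)); last first.
  by rewrite sumwv big1 // => i _; rewrite mxE.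
under [RHS]eq_bigr do rewrite summxE; rewrite exchange_big /=.
apply: eq_bigr => l _; under eq_bigr do rewrite mxE; rewrite -mulr_sumr.
by case: (vP l) => _ _ -> _; rewrite mulr1.
Qed.

(** The root of an edge [e] is the only point of the product of simplices where the
    linear functional [x e.1 - x e.2] reaches its maximum 2.  As it is a convex combination
    of the vertices of the simplex, some vertex reaches 2; distinct edges need distinct
    vertices, so the simplex has at least as many vertices as there are edges. *)
Lemma simplex_edge_bound (E : {set 'I_d * 'I_n}) (C : set 'rV[R]_(d + n)) :
  (0 < d)%N -> is_simplex C -> (forall x, C x -> simplex_product x) ->
  (forall e, e \in E -> C (root_vec R e.1 e.2)) -> (#|E| < d + n)%N.
Proof.
move=> d0 [m [v [indep CE]]] Cprod CEdge.
have vP j : simplex_product (v j).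
  by apply: Cprod; rewrite CE; apply: conv_sub; exists j.
apply: leq_ltn_trans (affinely_independent_bound d0 vP indep).
have vtx e : e \in E -> exists j, v j 0 (lshift n e.1) = 1 /\ v j 0 (rshift d e.2) = -1.
  move=> /CEdge; rewrite CE => -[m' [u [w [uP w0 w1 rE]]]].
  have uR j : exists l, u j = v l by case: (uP j) => l _ <-; exists l.
  have [||j uj] := @mean_attains_max R m' w
     (fun j => u j 0 (lshift n e.1) - u j 0 (rshift d e.2)) 2 w0 w1.
  - move=> j; have [l ->] := uR j.
    by have := simplex_product_le1 e.1 (vP l); have := simplex_product_geN1 e.2 (vP l); lra.
  - have := congr1 (fun x => x 0 (lshift n e.1) - x 0 (rshift d e.2)) rE.
    rewrite root_vec_lshift root_vec_rshift !eqxx !summxE -sumrB.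
    under eq_bigr do rewrite !mxE -mulrBr.
    by move=> <-; rewrite opprK -natrD.
  have [l ul] := uR j; exists l; rewrite -ul; rewrite ul in uj *.
  by have := simplex_product_le1 e.1 (vP l); have := simplex_product_geN1 e.2 (vP l);
     split; lra.
have [->|[e0 e0E]] := set_0Vmem E; first by rewrite cards0.
have [j0 _] := vtx _ e0E.
pose g e := odflt j0 [pick j | (v j 0 (lshift n e.1) == 1) && (v j 0 (rshift d e.2) == -1)].
have gP e : e \in E -> v (g e) 0 (lshift n e.1) = 1 /\ v (g e) 0 (rshift d e.2) = -1.
  rewrite /g; case: pickP => [j /andP[/eqP-> /eqP->]//|no] /vtx[j [h1 h2]].
  by have := no j; rewrite h1 h2 !eqxx.
rewrite -[m]card_ord -(card_in_imset (f := g) (D := E)); first exact: max_card.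
move=> e f /gP[e1 e2] /gP[f1 f2] gef; rewrite -gef in f1 f2.
exact: simplex_product_inj (vP (g e)) e1 e2 f1 f2.
Qed.

End RootPolytope.

(** * Genericity bounds the number of tight edges *)

Section Genericity.
Variables (R : realType) (d n : nat) (A : 'M[\bar R]_(d, n)).

(** The functional whose minimal face on the lifted roots consists of the tight ones:
    its value at the root of [(i, k)] is the slack [y k - (p i - a i k)]. *)
Definition price (p : 'I_d -> R) (y : 'I_n -> R) (x : 'rV[R]_(d + n) * R^o) : R :=
  x.2 - \sum_i p i * x.1 0 (lshift n i) - \sum_k y k * x.1 0 (rshift d k).

Lemma price_is_scalar p y : scalar (price p y).
Proof.
move=> c x z; rewrite /price /=.
under eq_bigr do rewrite !mxE mulrDr mulrCA.
under [X in _ - X = _]eq_bigr do rewrite !mxE mulrDr mulrCA.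
by rewrite !big_split /= -!mulr_sumr -[_ *: x.2]/(c * x.2); ring.
Qed.

HB.instance Definition _ p y := GRing.isLinear.Build R
  ('rV[R]_(d + n) * R^o)%type R _ (price p y) (price_is_scalar p y).

Local Notation B := (neighbours (support_graph A)).
Local Notation a := (fun i k => fine (A i k)).

Lemma in_neighbours i k : (i \in B k) = (A i k \is a fin_num).
Proof. by rewrite !inE. Qed.

Lemma price_root p y i k :
  price p y (root_vec R i k, fine (A i k)) = y k - (p i - fine (A i k)).
Proof.
rewrite /price /= (bigD1 i) //= root_vec_lshift eqxx big1 => [|j ji]; last first.
  by rewrite root_vec_lshift (negbTE ji) mulr0.
rewrite (bigD1 k) //= root_vec_rshift eqxx big1 => [|j jk]; last first.
  by rewrite root_vec_rshift (negbTE jk) oppr0 mulr0.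
by rewrite !mulr1n !addr0 mulr1 mulrN1 opprK opprB addrC.
Qed.

Lemma generic_tight_bound p y : (0 < d)%N -> sufficiently_generic A ->
  heights B a p y -> (\sum_k #|tight B a p y k| < d + n)%N.
Proof.
move=> d0 gen hpy.
pose L := conv (lifted_roots A).
pose F : set ('rV[R]_(d + n) * R^o) :=
  [set x | L x /\ forall z, L z -> price p y x <= price p y z]%classic.
have price0 z : L z -> 0 <= price p y z.
  apply: (conv_ge0 (f := price p y : {scalar _})) => s [i [k [ik ->]]].
  rewrite /= price_root subr_ge0; have [le_y _] := hpy k.
  by apply: le_y; rewrite inE.
have face : lower_face L F.
  exists (price p y : {scalar _}); split=> //.
  rewrite /= /price /= big1 => [|i _]; last by rewrite mxE mulr0.
  by rewrite big1 => [|k _]; rewrite ?mxE ?mulr0 // !subr0 ltr01.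
pose E := [set e : 'I_d * 'I_n | e.1 \in tight B a p y e.2]%SET.
have -> : (\sum_k #|tight B a p y k| = #|E|)%N.
  rewrite -sum1_card; under eq_bigr do rewrite -sum1_card.
  rewrite (exchange_big_dep predT) //= pair_big_dep /=.
  by apply: eq_bigl => -[i k] /=; rewrite [RHS]inE.
apply: (simplex_edge_bound (C := (fst @` F)%classic)) => //.
- by apply: gen; exists F.
- move=> _ [x [[m [v [w [vP w0 w1 ->]]]] _] <-].
  have vE l : (\sum_i w i *: v i).1 0 l = \sum_i w i * (v i).1 0 l.
    by elim/big_rec2: _ => [|i u z _ <-]; rewrite /= !mxE.
  have rt i : simplex_product (v i).1.
    by case: (vP i) => j [k [_ ->]]; apply: simplex_product_root.
  split=> [i|k||].
  + by rewrite vE; apply: sumr_ge0 => j _; apply: mulr_ge0 => //; case: (rt j).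
  + by rewrite vE; apply: sumr_le0 => j _; apply: mulr_ge0_le0 => //; case: (rt j).
  + under eq_bigr do rewrite vE; rewrite exchange_big /= -w1.
    by apply: eq_bigr => j _; rewrite -mulr_sumr; case: (rt j) => _ _ -> _; rewrite mulr1.
  + under eq_bigr do rewrite vE; rewrite exchange_big /= -w1 -sumrN.
    by apply: eq_bigr => j _; rewrite -mulr_sumr; case: (rt j) => _ _ _ ->; rewrite mulrN1.
- move=> [i k]; rewrite inE /= inE => /andP[Bi /eqP yk].
  exists (root_vec R i k, fine (A i k)) => //; split.
    by apply: conv_sub; exists i, k; split=> //; move: Bi; rewrite inE.
  by move=> z /price0; rewrite price_root yk subrr.
Qed.

End Genericity.

(** * Fine types of the vertices *)

Section Vertices.
Variables (R : realType) (d n : nat) (A : 'M[\bar R]_(d, n)).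
Hypothesis hA : tropical_matrix A.
Implicit Types (p q : 'rV[R]_d).

Local Notation B := (neighbours (support_graph A)).
Local Notation a := (fun i k => fine (A i k)).

Lemma neighbours_neq0 k : B k != set0.
Proof. by have [i fini] := hA.2 k; apply/set0Pn; exists i; rewrite in_neighbours. Qed.

(** An infinite entry contributes [-oo] to the comparisons that define a sector, so only
    the finite rows of a column matter. *)
Lemma fine_type_tight p y i k : heights B a (p 0) y ->
  fine_type A p i k = (i \in tight B a (p 0) y k).
Proof.
move=> hpy; have [le_y /set0Pn[j jk]] := hpy k.
rewrite mxE inE in_neighbours; case: (boolP (_ \is a fin_num)) => //= fini.
apply/idP/eqP => [|yk].
  move=> /set_mem/(_ j); move: jk; rewrite inE in_neighbours => /andP[finj /eqP jk].
  rewrite -(fineK fini) -(fineK finj) -!EFinB lee_fin jk => le_i.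
  by apply/le_anti; rewrite le_i le_y // in_neighbours.
apply: mem_set => l; case: (boolP (A l k \is a fin_num)) => [finl|].
  rewrite -(fineK fini) -(fineK finl) -!EFinB lee_fin yk.
  by apply: le_y; rewrite in_neighbours.
have := hA.1 l k; case: (A l k) => //= _ _.
by rewrite leNye.
Qed.

Lemma heights_row (p : 'I_d -> R) y : heights B a p y ->
  heights B a ((\row_i p i) 0) y.
Proof. by have -> : (\row_i p i) 0 = p by apply/funext => i; rewrite mxE. Qed.

Lemma mem_cell p y q z : heights B a (p 0) y -> heights B a (q 0) z ->
  cell A (fine_type A p) q <-> (forall k, tight B a (p 0) y k \subset tight B a (q 0) z k).
Proof.
move=> hp hq; split=> [cq k|sub i k].
  apply/fintype.subsetP => i; rewrite -(fine_type_tight _ _ hp) -(fine_type_tight _ _ hq).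
  exact: cq.
rewrite (fine_type_tight _ _ hp) (fine_type_tight _ _ hq).
exact: (fintype.subsetP (sub k)).
Qed.

(** A point of the cell has all the tight edges of [p], and when these connect all
    rows they determine it up to translation. *)
Lemma connected_cell p y : (0 < d)%N -> heights B a (p 0) y ->
  connected_family (tight B a (p 0) y) -> cell A (fine_type A p) = torus_point p.
Proof.
move=> d0 hp con; have d0' : (0 < #|{: 'I_d}|)%N by rewrite card_ord.
apply/seteqP; split=> [q|_ [c ->]].
  have [z hq] := heights_exist a (q 0) neighbours_neq0.
  move/(mem_cell hp hq) => sub.
  have [c [qE _]] := connected_translate d0' hp con sub.
  by exists c; apply/rowP => i; rewrite !mxE qE.
have tightE k : tight B a ((p + const_mx c) 0) (fun k => y k + c) k = tight B a (p 0) y k.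
  by apply/setP => i; rewrite !inE !mxE addrAC (inj_eq (addIr c)).
apply/(@mem_cell p y _ (fun k => y k + c)) => // k.
  have [le_y ne] := hp k; rewrite tightE; split=> // i Bi.
  by rewrite !mxE addrAC lerD2r; apply: le_y.
by rewrite tightE.
Qed.

(** Lowering one side of a proper splitting by a positive amount stays in the cell, but is
    not a translation. *)
Lemma cell_connected p y p0 : heights B a (p 0) y ->
  cell A (fine_type A p) = torus_point p0 -> connected_family (tight B a (p 0) y).
Proof.
move=> hp cellE U /set0Pn[i0 i0U] spl.
have [t t0 [t_le _]] := lower_step U hp.
have hq := heights_row (lower_heightsP hp (ltW t0) t_le).
set q := \row_i _ in hq.
have : cell A (fine_type A p) q.
  apply/(mem_cell hp hq) => k.
  have -> : q 0 = lower_point (p 0) U t by apply/funext => i; rewrite mxE.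
  exact: tight_lower_splits.
have : cell A (fine_type A p) p by apply/(mem_cell hp hp).
rewrite cellE => -[c pE] [c' qE].
apply/setP => i; rewrite inE; apply: contrapT => /negP iU.
have := congr1 (fun x : 'rV_d => x 0 i0) qE; have := congr1 (fun x : 'rV_d => x 0 i0) pE.
have := congr1 (fun x : 'rV_d => x 0 i) qE; have := congr1 (fun x : 'rV_d => x 0 i) pE.
rewrite /q !mxE /lower_point i0U (negbTE iU) mulr0n mulr1n; lra.
Qed.

Lemma torus_point_bounded p : torus_bounded (torus_point p).
Proof.
exists (\sum_i `|p 0 i|) => _ [c ->]; exists (- c) => i.
rewrite !mxE addrK (bigD1 i) //= lerDl.
by apply: sumr_ge0.
Qed.

Lemma vertex_fine_typeP T : (0 < d)%N -> vertex_fine_types A T <->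
  exists p y, [/\ heights B a (p 0) y, connected_family (tight B a (p 0) y)
    & T = fine_type A p].
Proof.
move=> d0; split=> [[[p _ <-] [_ [p0 cellE]]]|[p [y [hp con ->]]]].
  have [y hp] := heights_exist a (p 0) neighbours_neq0.
  by exists p, y; split=> //; apply: cell_connected hp cellE.
have cellE := connected_cell d0 hp con.
split; first by exists p.
split; last by exists p.
split; last by rewrite cellE; apply: torus_point_bounded.
by exists (fine_type A p) => //; exists p.
Qed.

Lemma right_degree_tight p y k : heights B a (p 0) y ->
  (map_mx Posz (right_degree (fine_type A p)) - const_mx 1) 0 k =
    #|tight B a (p 0) y k|.-1%:Z.
Proof.
move=> hp; have [_] := hp k; rewrite -card_gt0.
have -> : #|tight B a (p 0) y k| = right_degree (fine_type A p) 0 k.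
  rewrite mxE -sum1_card big_mkcond /=.
  by apply: eq_bigr => i _; rewrite (fine_type_tight _ _ hp); case: (_ \in _).
by rewrite !mxE; lia.
Qed.

End Vertices.

Local Open Scope classical_set_scope.

Theorem corollary4p24 (R : realType) (d n : nat) (hd : (0 < d)%N)
    (A : 'M[\bar R]_(d, n)) (hA : tropical_matrix A)
    (hgen : sufficiently_generic A) :
  [set a : 'rV[int]_n | draconian (support_graph A) a] =
  [set map_mx Posz (right_degree T) - const_mx 1 | T in vertex_fine_types A].
Proof.
pose B := neighbours (support_graph A); pose a i k := fine (A i k).
have d0 : (0 < #|{: 'I_d}|)%N by rewrite card_ord.
apply/seteqP; split=> [al /= drac|_ [T /(vertex_fine_typeP hA _ hd)[p [y [hp con ->]]] <-]].
  have alE k : al 0 k = (absz (al 0%R k))%:Z by case: drac => ge0 _ _; rewrite gez0_abs.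
  have drag := (draconianP _ alE).1 drac.
  have [p [y [hp con [total dragT]]]] := draconian_attained a d0 drag.
  have hrow := heights_row hp.
  have rowE : (\row_i p i) 0 = p by apply/funext => i; rewrite mxE.
  exists (fine_type A (\row_i p i)).
    by apply/(vertex_fine_typeP hA _ hd); exists (\row_i p i), y; split; rewrite ?rowE.
  have deg k : ((absz (al 0%R k)).+1 <= #|tight B a p y k|)%N.
    exact: draconian_lt_card k (conj total dragT).
  have degE := leq_sum_eq deg _.
  apply/rowP => k; rewrite (right_degree_tight hA _ hrow) rowE -degE.
    by rewrite [RHS]alE.
  move: (generic_tight_bound hd hgen hp).
  have -> : (\sum_k (absz (al 0%R k)).+1 = \sum_k absz (al 0%R k) + n)%N.
    under eq_bigr do rewrite -addn1.
    by rewrite big_split /= sum1_card card_ord.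
  move=> edges; rewrite -ltnS; apply: leq_trans edges _.
  by rewrite -addSn -[X in (_ <= X + _)%N]addn1 total card_ord.
rewrite /=; apply/(@draconianP _ _ _ _ (fun k => #|tight B a (p 0) y k|.-1)).
  by move=> k; apply: right_degree_tight.
apply: (@draconian_seq_mono _ _ (tight B a (p 0) y)).
  by move=> k; apply/fintype.subsetP => i; rewrite inE => /andP[].
apply: draconian_of_tree => // [k|].
  by have [_] := hp k; rewrite -card_gt0.
by rewrite !card_ord; apply: generic_tight_bound.
Qed.
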